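(* Let $X\subseteq\{0,1\}^n$, $f_k:X\to\mathbb{R}$ for $k\in[K]$, and $f(x)=\min\{f_1(x),\dots,f_K(x)\}$ for $x\in X$. Suppose that for each $k\in[K]$ $$\operatorname{conv}(\operatorname{epi}(f_k))=\bigl\{(\mu_k,x)\in\mathbb{R}\times\mathbb{R}^n\bigm|\exists\,y_k\in\mathbb{R}^{m_k}\text{ s.t. }d_k\le D_k\mu_k+A_kx+B_ky_k\bigr\},$$ where $A_k,B_k$ are matrices and $D_k,d_k$ are vectors of appropriate dimensions with $D_k\ge0$. Then the separation problem for $\operatorname{conv}(f)$ at any $\bar x\in\operatorname{conv}(X)$ can be solved via the linear program $$\max_{\alpha_0,\alpha,(\lambda_k)_{k\in[K]}}\Bigl\{\alpha_0+\alpha^\intercal\bar x\ \Bigm|\ d_k^\intercal\lambda_k\ge\alpha_0,\ D_k^\intercal\lambda_k=1,\ A_k^\intercal\lambda_k=-\alpha,\ B_k^\intercal\lambda_k=0,\ \lambda_k\ge0\ \text{ for }k\in[K]\Bigr\}.$$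
   Context: $[K]=\{1,\dots,K\}$. $\operatorname{epi}(f_k)=\{(\mu,x)\mid x\in X,\ \mu\ge f_k(x)\}$. $\operatorname{conv}(f)$ is the convex envelope of $f$: the largest convex function on $\operatorname{conv}(X)$ that is $\le f$ on $X$. The separation problem for $\operatorname{conv}(f)$ at $(\bar x,\bar\mu)$ with $\bar x\in\operatorname{conv}(X)$ asks to either conclude $\bar\mu\ge\operatorname{conv}(f)(\bar x)$, or find an affine underestimator $\alpha^\intercal x+\alpha_0$ of $\operatorname{conv}(f)$ on $\operatorname{conv}(X)$ with $\bar\mu<\alpha^\intercal\bar x+\alpha_0$. ''Solved via the LP'' means: the optimal value of the LP equals $\operatorname{conv}(f)(\bar x)$, and the components $(\alpha_0,\alpha)$ of an optimal solution define an affine underestimator $\alpha_0+\alpha^\intercal x$ of $\operatorname{conv}(f)$ that attains this value at $\bar x$. *)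

(* Defs.v *)
From HB Require Import structures.
From mathcomp Require Import all_boot all_order all_algebra.
From mathcomp Require Import interval_inference.
From mathcomp Require Import mathcomp_extra boolp classical_sets functions
  cardinality reals topology convex.

Set Implicit Arguments.
Unset Strict Implicit.
Unset Printing Implicit Defensive.

Import Order.TTheory GRing.Theory Num.Theory.

Local Open Scope classical_set_scope.
Local Open Scope ring_scope.

Section Convexity.
Context {R : realType}.

Definition conv_hull (E : lmodType R) (S : set E) : set E :=
  smallest (@convex_set R E) S.

(* A function on a subset of R^n is a total function of which only the values
   on that subset are ever used.  Pairs are (mu, x); [R^o] makes R * R^n an
   R-module. *)
Definition epigraph n (X : set 'cV[R]_n) (f : 'cV[R]_n -> R) :
    set (R^o * 'cV[R]_n)%type :=
  [set z | X z.2 /\ f z.2 <= z.1].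

Definition convex_minorant n (X : set 'cV[R]_n) (f g : 'cV[R]_n -> R) : Prop :=
  @convex_function R 'cV[R]_n (conv_hull X) g /\ forall x, X x -> g x <= f x.

Definition is_convex_envelope n (X : set 'cV[R]_n) (f g : 'cV[R]_n -> R) :
    Prop :=
  convex_minorant X f g /\
  forall h, convex_minorant X f h -> forall x, conv_hull X x -> h x <= g x.

(* Existence for X inside {0,1}^n is [convex_envelopeP] below; the values on
   conv(X) are then uniquely determined, those outside are meaningless. *)
Definition convex_envelope n (X : set 'cV[R]_n) (f : 'cV[R]_n -> R) :
    'cV[R]_n -> R :=
  xget (fun=> 0) [set g | is_convex_envelope X f g].

Definition binary n : set 'cV[R]_n :=
  [set x | forall i, x i 0 = 0 \/ x i 0 = 1].

(* f_0 serves as the initial value of the iterated minimum, so 0 < K is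
   needed. *)
Definition pointwise_min K (K_gt0 : (0 < K)%N) (T : Type) (f : 'I_K -> T -> R)
    (x : T) : R :=
  \big[Num.min/f (Ordinal K_gt0) x]_(k < K) f k x.

Definition le_entry m (u v : 'cV[R]_m) : Prop := forall i, u i 0 <= v i 0.

Definition dot m (u v : 'cV[R]_m) : R := (u^T *m v) 0 0.

Definition affine n (a0 : R) (a x : 'cV[R]_n) : R := a0 + dot a x.

Definition projected_polyhedron n m p (D : 'cV[R]_p) (A : 'M[R]_(p, n))
    (B : 'M[R]_(p, m)) (d : 'cV[R]_p) : set (R^o * 'cV[R]_n)%type :=
  [set z | exists y : 'cV[R]_m,
     le_entry d ((z.1 : R) *: D + A *m z.2 + B *m y)].

Section LP.
Context {K n : nat} {m p : 'I_K -> nat}.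
Variables (D : forall k, 'cV[R]_(p k)) (A : forall k, 'M[R]_(p k, n))
  (B : forall k, 'M[R]_(p k, m k)) (d : forall k, 'cV[R]_(p k)).

Definition lp_feasible (a0 : R) (a : 'cV[R]_n)
    (lam : forall k, 'cV[R]_(p k)) : Prop :=
  forall k, [/\ a0 <= dot (d k) (lam k),
                dot (D k) (lam k) = 1,
                (A k)^T *m lam k = - a,
                (B k)^T *m lam k = 0
              & le_entry 0 (lam k)].

Definition lp_optimal (xbar : 'cV[R]_n) (a0 : R) (a : 'cV[R]_n)
    (lam : forall k, 'cV[R]_(p k)) : Prop :=
  lp_feasible a0 a lam /\
  forall b0 b mu, lp_feasible b0 b mu -> affine b0 b xbar <= affine a0 a xbar.

(* An optimal value is understood as an attained maximum. *)
Definition lp_value (xbar : 'cV[R]_n) (v : R) : Prop :=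
  exists a0 a lam, lp_optimal xbar a0 a lam /\ affine a0 a xbar = v.

End LP.

Lemma sub_conv_hull (E : lmodType R) (S : set E) : S `<=` conv_hull S.
Proof. exact: sub_smallest. Qed.

Lemma conv_hull_convex (E : lmodType R) (S : set E) :
  @convex_set R E (conv_hull S).
Proof.
move=> x y t /set_mem xS /set_mem yS; apply/mem_set => C [cC SC].
by apply/set_mem/cC; apply/mem_set; [exact: xS|exact: yS].
Qed.

Lemma binary_finite n : finite_set (binary (n := n)).
Proof.
pose F (b : 'cV[bool]_n) : 'cV[R]_n := map_mx (fun c : bool => c%:R) b.
apply: (@sub_finite_set _ _ [set F b | b in [set: 'cV[bool]_n]]).
  move=> x bx; exists (\col_i (x i 0 == 1)) => //.
  apply/matrixP => i j; rewrite !mxE ord1.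
  by case: (bx i) => ->; rewrite ?eqxx // eq_sym oner_eq0.
exact/finite_image/finite_finset.
Qed.

Lemma convex_envelopeP n (X : set 'cV[R]_n) (f : 'cV[R]_n -> R) :
  X `<=` binary (n := n) -> is_convex_envelope X f (convex_envelope X f).
Proof.
move=> Xbin; rewrite /convex_envelope.
suff [g gP] : exists g, is_convex_envelope X f g.
  by case: xgetP => [g' _ //|/(_ g)].
pose vals x := [set h x | h in convex_minorant X f].
have finX : finite_set X by apply: sub_finite_set Xbin _; exact: binary_finite.
have [c cP] : exists c, forall x, X x -> c <= f x.
  have /finite_seqP [s sE] := finX.
  exists (\big[Num.min/0]_(x <- s) f x) => x; rewrite sE /= => xs.
  exact: ge_bigmin_seq.
have cm : convex_minorant X f (fun=> c).
  by split=> // t x y _ _; rewrite convmm.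
have vals0 x : vals x !=set0 by exists c, (fun=> c).
have valsb : conv_hull X `<=` [set x | has_ubound (vals x) /\ conv_hull X x].
  apply: smallest_sub => [x y t /set_mem[[M MP] xX] /set_mem[[N NP] yX]|x xX].
    apply/mem_set; split; last first.
      by apply/set_mem/conv_hull_convex; exact/mem_set.
    exists (t%:num * M + (1 - t%:num) * N) => _ [h hm <-].
    apply: le_trans (hm.1 t x y (mem_set xX) (mem_set yX)) _.
    rewrite convRE; apply: lerD; apply: ler_wpM2l => //.
    - by apply: MP; exists h.
    - by rewrite subr_ge0.
    - by apply: NP; exists h.
  by split; [exists (f x) => _ [h [_ hf] <-]; exact: hf|exact: sub_conv_hull].
exists (fun x => sup (vals x)); split; [split=> [t x y xX yX|x xX]|].
- apply: ge_sup => // _ [h hm <-].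
  apply: le_trans (hm.1 t x y xX yX) _.
  rewrite !convRE; apply: lerD; apply: ler_wpM2l => //.
  + by apply: ub_le_sup; [case: (valsb _ (set_mem xX))|exists h].
  + by rewrite subr_ge0.
  + by apply: ub_le_sup; [case: (valsb _ (set_mem yX))|exists h].
- by apply: ge_sup => // _ [h [_ hf] <-]; exact: hf.
- move=> h hm x xX; apply: ub_le_sup; first by case: (valsb _ xX).
  by exists h.
Qed.

End Convexity.

(* Main.v *)
Require Import Defs.
From HB Require Import structures.
From mathcomp Require Import all_boot all_order all_algebra.
From mathcomp Require Import ring lra.
From mathcomp Require Import interval_inference boolp classical_sets cardinality
  reals convex.

Set Implicit Arguments.
Unset Strict Implicit.
Unset Printing Implicit Defensive.

Import Order.TTheory GRing.Theory Num.Theory.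

Local Open Scope classical_set_scope.
Local Open Scope ring_scope.

(** Put cf = conv(f).  Both halves of the claim follow from two facts: the
    pairs (a0, a) which the linear program admits are exactly the affine
    functions a0 + a^T x lying below f on X, and one of these touches cf at
    xbar.

    Admissible points are minorants.  The affine function a0 + a^T x is below
    f iff it is below every f_k on X, i.e. iff mu - a^T x >= a0 on
    conv(epi f_k), because the half-space containing epi f_k contains its
    hull.  By hypothesis this hull is the projection of a polyhedron, so the
    condition says that a linear inequality holds on a polyhedron, and it is
    nonempty as X is.  The affine form of Farkas' lemma ([affine_farkas])
    turns validity into the existence of multipliers lam_k satisfying exactly
    the k-th block of constraints of the linear program ([certificate_exists]);
    conversely such multipliers prove validity by weak duality
    ([certificate_minorant]).  The normalisation D_k^T lam_k = 1 is the
    coefficient of mu.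

    Minorants against the envelope.  An affine minorant of f is in particular
    a convex one, hence lies below cf on conv(X) ([affine_le_envelope]).  So
    the program is bounded by cf(xbar), and it remains to find an affine
    minorant with that value ([envelope_support]).  Since X is finite,
    a minorant cf(xbar) + a^T (x - xbar) exists by Farkas' lemma unless some
    weights w >= 0 with sum_x w_x (x - xbar) = 0 have
    sum_x w_x (f(x) - cf(xbar)) < 0; Jensen's inequality for cf
    ([jensen_conic]) excludes this. *)

(** * Inner products and entrywise inequalities *)

Section Dot.
Context {R : realType}.

Lemma dotE m (u v : 'cV[R]_m) : dot u v = \sum_i u i 0 * v i 0.
Proof. by rewrite /dot mxE; apply: eq_bigr => i _; rewrite mxE. Qed.

Lemma dotC m (u v : 'cV[R]_m) : dot u v = dot v u.
Proof. by rewrite !dotE; apply: eq_bigr => i _; rewrite mulrC. Qed.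

Lemma dotDr m (u v w : 'cV[R]_m) : dot u (v + w) = dot u v + dot u w.
Proof. by rewrite /dot mulmxDr mxE. Qed.

Lemma dotZr m c (u v : 'cV[R]_m) : dot u (c *: v) = c * dot u v.
Proof. by rewrite /dot -scalemxAr mxE. Qed.

Lemma dotNr m (u v : 'cV[R]_m) : dot u (- v) = - dot u v.
Proof. by rewrite /dot mulmxN mxE. Qed.

Lemma dot0r m (u : 'cV[R]_m) : dot u 0 = 0.
Proof. by rewrite /dot mulmx0 mxE. Qed.

Lemma dotDl m (u v w : 'cV[R]_m) : dot (u + v) w = dot u w + dot v w.
Proof. by rewrite !(dotC _ w) dotDr. Qed.

Lemma dotZl m c (u v : 'cV[R]_m) : dot (c *: u) v = c * dot u v.
Proof. by rewrite !(dotC _ v) dotZr. Qed.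

Lemma dotNl m (u v : 'cV[R]_m) : dot (- u) v = - dot u v.
Proof. by rewrite !(dotC _ v) dotNr. Qed.

Lemma dot0l m (u : 'cV[R]_m) : dot 0 u = 0.
Proof. by rewrite dotC dot0r. Qed.

Lemma dot_trmx m n (M : 'M[R]_(m, n)) u v :
  dot (M *m u) v = dot u (M^T *m v).
Proof. by rewrite /dot trmx_mul mulmxA. Qed.

Lemma dot_col_mx m n (u u' : 'cV[R]_m) (v v' : 'cV[R]_n) :
  dot (col_mx u v) (col_mx u' v') = dot u u' + dot v v'.
Proof. by rewrite /dot tr_col_mx mul_row_col mxE. Qed.

Lemma dot_scalar (u v : 'cV[R]_1) : dot u v = u 0 0 * v 0 0.
Proof. by rewrite dotE big_ord1. Qed.

Lemma le_entry_subr m (u v : 'cV[R]_m) : le_entry u v <-> le_entry 0 (v - u).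
Proof.
by split=> uv i; have := uv i; rewrite !mxE subr_ge0.
Qed.

Lemma le_entry_col_mx m n (u u' : 'cV[R]_m) (v v' : 'cV[R]_n) :
  le_entry (col_mx u v) (col_mx u' v') <-> le_entry u u' /\ le_entry v v'.
Proof.
split=> [le_uv|[le_u le_v] i].
  split=> i; first by have := le_uv (lshift n i); rewrite !col_mxEu.
  by have := le_uv (rshift m i); rewrite !col_mxEd.
by case: (split_ordP i) => j ->; rewrite ?col_mxEu ?col_mxEd.
Qed.

Lemma le_entry0_col_mx m n (u : 'cV[R]_m) (v : 'cV[R]_n) :
  le_entry 0 (col_mx u v) <-> le_entry 0 u /\ le_entry 0 v.
Proof. by rewrite -col_mx0; exact: le_entry_col_mx. Qed.

Lemma le_entry0_scalar (c : R) : le_entry 0 (c%:M : 'cV_1) <-> 0 <= c.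
Proof.
by split=> [/(_ 0)|c_ge0 i]; rewrite ?ord1 !mxE mulr1n.
Qed.

Lemma dot_ge0 m (u v : 'cV[R]_m) :
  le_entry 0 u -> le_entry 0 v -> 0 <= dot u v.
Proof.
move=> u_ge0 v_ge0; rewrite dotE; apply: sumr_ge0 => i _.
by apply: mulr_ge0; [have := u_ge0 i|have := v_ge0 i]; rewrite mxE.
Qed.

Lemma le_dot m (u v w : 'cV[R]_m) :
  le_entry 0 w -> le_entry u v -> dot u w <= dot v w.
Proof.
move=> w_ge0 /le_entry_subr uv.
by rewrite -subr_ge0 -dotNl -dotDl; exact: dot_ge0.
Qed.

End Dot.

(** * Farkas' lemma and two of its variants *)

Section Farkas.
Context {R : realType}.

(** Bartl's algebraic proof, by induction on the number of inequalities.  If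
    the first inequality r^T z >= 0 is needed, some x satisfies the others,
    violates it, and has c^T x < 0; scaled so that r^T x = -1, it defines the
    projection z |-> z + (r^T z) x onto the hyperplane r^T z = 0.  Composing
    all remaining functionals with this projection removes r, and undoing the
    composition yields the multiplier of r, positive by the sign of c^T x. *)
Lemma farkas m q (M : 'M[R]_(m, q)) (c : 'cV[R]_q) :
    (forall z, le_entry 0 (M *m z) -> 0 <= dot c z) ->
  exists2 l : 'cV[R]_m, le_entry 0 l & M^T *m l = c.
Proof.
elim: m M c => [|m IHm]; last rewrite -[m.+1]add1n; move=> M c Mc.
  exists 0 => [i|]; first by rewrite mxE.
  have c_ge0 z : 0 <= dot c z by apply: Mc => -[].
  rewrite mulmx0; apply/esym/matrixP => i j; rewrite ord1 mxE.
  apply: le_anti; have := c_ge0 (delta_mx i 0); have := c_ge0 (- delta_mx i 0).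
  by rewrite dotNr /dot -colE !mxE oppr_ge0 => -> ->.
pose r := usubmx M; pose N := dsubmx M.
have ME : M = col_mx r N by rewrite vsubmxK.
have rE z : r *m z = (dot r^T z)%:M by rewrite [LHS]mx11_scalar /dot trmxK.
have {Mc} rNc z : 0 <= dot r^T z -> le_entry 0 (N *m z) -> 0 <= dot c z.
  move=> rz Nz; apply: Mc; rewrite ME mul_col_mx.
  by apply/le_entry0_col_mx; rewrite rE le_entry0_scalar.
(* If r is redundant it gets the multiplier 0. *)
have [Nc|] := pselect (forall z, le_entry 0 (N *m z) -> 0 <= dot c z).
  have [l l_ge0 lE] := IHm _ _ Nc.
  exists (col_mx 0 l).
    by apply/le_entry0_col_mx; split=> // i; rewrite mxE.
  by rewrite ME tr_col_mx mul_row_col mulmx0 add0r.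
move=> /existsNP[z /not_implyP[Nz /negP]]; rewrite -ltNge => cz.
have rz : dot r^T z < 0.
  by rewrite ltNge; apply/negP => rz; have := rNc _ rz Nz; rewrite leNgt cz.
have [x [rx cx Nx]] : exists x : 'cV_q,
    [/\ dot r^T x = -1, dot c x < 0 & le_entry 0 (N *m x)].
  have s_gt0 : 0 < (- dot r^T z)^-1 by rewrite invr_gt0 oppr_gt0.
  exists ((- dot r^T z)^-1 *: z); split.
  - by rewrite dotZr invrN mulNr mulVf // lt_eqF.
  - by rewrite dotZr pmulr_rlt0.
  - move=> i; rewrite -scalemxAr !mxE; apply: mulr_ge0; first exact: ltW.
    by have := Nz i; rewrite !mxE.
(* The functionals composed with the projection along x. *)
have NcS y : le_entry 0 ((N + N *m x *m r) *m y) ->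
    0 <= dot (c + dot c x *: r^T) y.
  move=> Ny.
  have -> : dot (c + dot c x *: r^T) y = dot c (y + dot r^T y *: x).
    by rewrite dotDl dotDr dotZl dotZr mulrC.
  apply: rNc; first by rewrite dotDr dotZr rx mulrN1 subrr.
  by move: Ny; rewrite mulmxDl -mulmxA rE mul_mx_scalar mulmxDr -scalemxAr.
have [l l_ge0 lE] := IHm _ _ NcS.
exists (col_mx (dot (N *m x) l - dot c x)%:M l).
  apply/le_entry0_col_mx; split=> //; apply/le_entry0_scalar.
  by rewrite subr_ge0 (le_trans (ltW cx)) // ?dot_ge0.
rewrite ME tr_col_mx mul_row_col mul_mx_scalar.
have := lE; rewrite linearD /= trmx_mul mulmxDl -mulmxA.
rewrite [(N *m x)^T *m l]mx11_scalar -/(dot _ l) mul_mx_scalar => NE.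
by rewrite scalerBl addrAC [_ + N^T *m l]addrC NE addrK.
Qed.

(** Farkas' lemma applied to the homogenisation: M z >= s d and s >= 0 imply
    c^T z >= s b.  For s > 0 this is the assumption at z / s; for s = 0 it says
    that c is nonnegative on the recession cone, which can fail for an empty
    polyhedron; hence the point z0. *)
Lemma affine_farkas m q (M : 'M[R]_(m, q)) (d : 'cV[R]_m) (c : 'cV[R]_q) b z0 :
    le_entry d (M *m z0) ->
    (forall z, le_entry d (M *m z) -> b <= dot c z) ->
  exists l : 'cV[R]_m, [/\ le_entry 0 l, M^T *m l = c & b <= dot d l].
Proof.
move=> Mz0 Mc.
pose M' := block_mx M (- d) (0 : 'rV_q) (1%:M : 'M_1).
have [z|l l_ge0] := @farkas _ _ M' (col_mx c (- b)%:M).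
  rewrite -[z]vsubmxK; move: (usubmx z) (dsubmx z) => {}z s.
  rewrite mul_block_col dot_col_mx [s]mx11_scalar; move: (s 0 0) => {}s.
  rewrite mul0mx add0r mul1mx mul_mx_scalar scalerN dot_scalar !mxE !mulr1n.
  move=> /le_entry0_col_mx[Ms /le_entry0_scalar s_ge0].
  have [s_gt0|s_le0] := ltP 0 s.
    have : b <= dot c (s^-1 *: z).
      apply: Mc => i; have := Ms i; rewrite -scalemxAr !mxE => Msi.
      by rewrite ler_pdivlMl // -subr_ge0.
    by rewrite dotZr ler_pdivlMl // mulrC mulNr subr_ge0.
  have s0 : s = 0 by apply/le_anti; rewrite s_le0.
  rewrite s0 mulr0 addr0; rewrite {}s0 scale0r subr0 in Ms.
  (* Moving from z0 along the recession direction z until c^T takes the value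
     b - 1 would contradict the bound b. *)
  rewrite leNgt; apply/negP => cz.
  have cz0 := Mc _ Mz0; pose t := (b - 1 - dot c z0) / dot c z.
  have t_ge0 : 0 <= t.
    by apply: mulr_le0; [rewrite addrAC; lra|rewrite invr_le0 ltW].
  have /Mc : le_entry d (M *m (z0 + t *: z)).
    move=> i; rewrite mulmxDr -scalemxAr [_ i 0 in leRHS]mxE.
    rewrite (le_trans (Mz0 i)) // lerDl !mxE mulr_ge0 //.
    by have := Ms i; rewrite !mxE.
  by rewrite dotDr dotZr divfK ?lt_eqF // addrC subrK; lra.
rewrite -[l]vsubmxK in l_ge0 *; move: l_ge0.
move: (usubmx l) (dsubmx l) => {}l s /le_entry0_col_mx[l_ge0 s_ge0].
rewrite tr_block_mx mul_block_col trmx0 trmx1 mul0mx addr0 mul1mx.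
move=> /eq_col_mx[lE bE]; exists l; split=> //.
move: s_ge0 => /(_ 0); move/matrixP: bE => /(_ 0 0).
rewrite linearN mulNmx /= !mxE mulr1n => /eqP.
have -> : \sum_j d^T 0 j * l j 0 = dot d l by rewrite /dot mxE.
by move=> /eqP ? ?; lra.
Qed.

(** Farkas' lemma for z >= 0, M z >= 0, - M z >= 0; the slack c - M^T u is the
    multiplier of z >= 0, and u is the difference of the two others. *)
Lemma farkas_eq m q (M : 'M[R]_(m, q)) (c : 'cV[R]_q) :
    (forall z, le_entry 0 z -> M *m z = 0 -> 0 <= dot c z) ->
  exists u : 'cV[R]_m, le_entry (M^T *m u) c.
Proof.
move=> Mc.
have [z|l] := @farkas _ _ (col_mx 1%:M (col_mx M (- M))) c.
  rewrite !mul_col_mx mul1mx mulNmx => /le_entry0_col_mx[z_ge0].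
  move=> /le_entry0_col_mx[Mz_ge0 Mz_le0]; apply: Mc => //.
  apply/matrixP => i j; rewrite ord1 mxE; apply: le_anti.
  by have := Mz_ge0 i; have := Mz_le0 i; rewrite !mxE oppr_ge0 => -> ->.
rewrite -[l]vsubmxK -[dsubmx l]vsubmxK.
move: (usubmx l) (usubmx (dsubmx l)) (dsubmx (dsubmx l)) => s u v.
move=> /le_entry0_col_mx[s_ge0 _].
rewrite !tr_col_mx !mul_row_col trmx1 mul1mx linearN mulNmx -mulmxBr => <-.
by exists (u - v); apply/le_entry_subr; rewrite addrK.
Qed.
End Farkas.

(** * Jensen's inequality *)

Section Jensen.
Context {R : realType}.

(** Weights are not normalised, so that the induction needs no division unless
    the total weight is positive.  The point y0 is a barycentre for the
    case where all weights vanish. *)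
Lemma jensen_conic (E : lmodType R) (C : set E) (g : E -> R) (I : Type)
    (r : seq I) (w : I -> R) (x : I -> E) y0 :
    @convex_set R E C -> @convex_function R E C g -> C y0 ->
    (forall i, 0 <= w i) -> (forall i, C (x i)) ->
  exists y, [/\ C y, \sum_(i <- r) w i *: x i = (\sum_(i <- r) w i) *: y
    & (\sum_(i <- r) w i) * g y <= \sum_(i <- r) w i * g (x i)].
Proof.
move=> Cconv gconv Cy0 w_ge0 Cx; elim: r => [|i r [y [Cy xE gy]]].
  by exists y0; rewrite !big_nil scale0r mul0r.
rewrite !big_cons xE; set W := \sum_(j <- r) w j in xE gy *.
have W_ge0 : 0 <= W by apply: sumr_ge0 => j _.
have [W0|Wneq0] := eqVneq (w i + W) 0.
  have [-> W_0] : w i = 0 /\ W = 0 by have := w_ge0 i; split; lra.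
  exists y; split=> //; first by rewrite W_0 !(addr0, scale0r).
  by rewrite !mul0r !add0r.
have W_gt0 : 0 < w i + W by rewrite lt_def Wneq0 addr_ge0.
have t_ge0 : 0 <= w i / (w i + W) by rewrite divr_ge0 // ltW.
have t_le1 : w i / (w i + W) <= 1 by rewrite ler_pdivrMr // mul1r lerDl.
have [t tE] : exists t : {i01 R}, (w i + W) * t%:num = w i.
  by exists (Itv01 t_ge0 t_le1); rewrite /= mulrC divfK.
have tCE : (w i + W) * (1 - t%:num) = W.
  by rewrite mulrBr tE mulr1 addrAC subrr add0r.
exists (t%:num *: x i + (1 - t%:num) *: y); split.
- by apply/set_mem/(Cconv (x i) y t); apply/mem_set.
- by rewrite scalerDr !scalerA tE tCE.
- have := gconv t (x i) y (mem_set (Cx i)) (mem_set Cy).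
  rewrite convRE -(ler_pM2l W_gt0) mulrDr !mulrA tE tCE => /le_trans; apply.
  by rewrite lerD2l.
Qed.

End Jensen.

(** * Affine minorants and the convex envelope *)

Section Envelope.
Context {R : realType} {n : nat}.
Implicit Types (X : set 'cV[R]_n) (f : 'cV[R]_n -> R).

Lemma conv_hull_nonempty X x : conv_hull X x -> X !=set0.
Proof.
by apply: (@smallest_sub _ _ X [set _ | X !=set0]) => // y Xy; exists y.
Qed.

Lemma affine_comb a0 (a x y : 'cV[R]_n) t :
  affine a0 a (t *: x + (1 - t) *: y) =
  t * affine a0 a x + (1 - t) * affine a0 a y.
Proof. by rewrite /affine dotDr !dotZr; ring. Qed.

(** An affine function is convex, so the maximality of the envelope applies. *)
Lemma affine_le_envelope X f a0 a :
    X `<=` binary (n := n) -> (forall x, X x -> affine a0 a x <= f x) ->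
  forall x, conv_hull X x -> affine a0 a x <= convex_envelope X f x.
Proof.
move=> Xbin le_f; apply: (convex_envelopeP f Xbin).2.
split=> // t x y _ _; rewrite le_eqVlt; apply/orP; left.
exact/eqP/affine_comb.
Qed.

(** The envelope of a function on a finite set is polyhedral, hence has
    a supporting affine function even at boundary points of conv(X); the slope
    comes from [farkas_eq], whose hypothesis is Jensen's inequality. *)
Lemma envelope_support X f xbar :
    X `<=` binary (n := n) -> conv_hull X xbar ->
  exists a0 a, (forall x, X x -> affine a0 a x <= f x) /\
    affine a0 a xbar = convex_envelope X f xbar.
Proof.
move=> Xbin Xxbar.
have [[cf_conv cf_le] _] := convex_envelopeP f Xbin.
set cf := convex_envelope X f in cf_conv cf_le *.
have /finite_seqP[s Xs] : finite_set X.
  exact: sub_finite_set Xbin (binary_finite _).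
pose x (i : 'I_(size s)) := tnth (in_tuple s) i.
have Xx i : X (x i) by rewrite Xs /=; exact: mem_tnth.
pose M := \matrix_(i < n, j < size s) (x j - xbar) i 0.
have [w w_ge0 Mw|a aP] := @farkas_eq _ _ _ M (\col_j (f (x j) - cf xbar)).
  have {}w_ge0 j : 0 <= w j 0 by have := w_ge0 j; rewrite mxE.
  have [y [_ wxE le_wf]] := jensen_conic (index_enum _)
    (@conv_hull_convex _ _ _) cf_conv Xxbar w_ge0
    (fun i => sub_conv_hull (Xx i)).
  set W := \sum_i w i 0 in wxE le_wf.
  have wxbar : \sum_i w i 0 *: x i = W *: xbar.
    apply/eqP; rewrite scaler_suml -subr_eq0 -sumrB; apply/eqP/matrixP => i j.
    move/matrixP/(_ i 0): Mw; rewrite ord1 => <-; rewrite summxE mxE.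
    by apply: eq_bigr => k _; rewrite !mxE; ring.
  (* The barycentre y of the x_j with weights w is xbar, unless w = 0. *)
  have {le_wf} : W * cf xbar <= \sum_i w i 0 * cf (x i).
    have [W0|W_neq0] := eqVneq W 0.
      by rewrite W0 !mul0r in le_wf *.
    suff <- : y = xbar by [].
    by apply: (scalerI W_neq0); rewrite -wxE wxbar.
  move=> le_wf; rewrite dotE.
  rewrite (eq_bigr (fun i => w i 0 * f (x i) - w i 0 * cf xbar)); last first.
    by move=> i _; rewrite mxE; ring.
  rewrite sumrB -mulr_suml subr_ge0 (le_trans le_wf) // ler_sum // => i _.
  by rewrite ler_wpM2l // cf_le.
exists (cf xbar - dot a xbar), a; split=> [z|]; last by rewrite /affine subrK.
rewrite Xs /= => /(tnthP (in_tuple s))[i ->]; have := aP i.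
rewrite -/(x i) /affine !mxE lerBrDl -addrA [- _ + _]addrC -dotNr -dotDr.
rewrite dotC dotE.
apply: le_trans; rewrite lerD2l ler_sum // => k _.
by rewrite !mxE.
Qed.

End Envelope.

(** * Affine minorants of one function as dual multipliers *)

Section Duality.
Context {R : realType} {n m p : nat}.
Variables (D : 'cV[R]_p) (A : 'M[R]_(p, n)) (B : 'M[R]_(p, m)) (d : 'cV[R]_p).
Implicit Types (X : set 'cV[R]_n) (f : 'cV[R]_n -> R).

(** The k-th block of constraints of the linear program; lam certifies that
    a0 + a^T x lies below the function with the given epigraph. *)
Definition certificate (a0 : R) (a : 'cV[R]_n) (lam : 'cV[R]_p) : Prop :=
  [/\ a0 <= dot d lam, dot D lam = 1, A^T *m lam = - a, B^T *m lam = 0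
    & le_entry 0 lam].

Lemma conv_hull_epigraph_ge X f a0 a :
    (forall x, X x -> affine a0 a x <= f x) ->
  forall z, conv_hull (epigraph X f) z -> affine a0 a z.2 <= z.1.
Proof.
move=> le_f; apply: (@smallest_sub _ _ _ [set z | affine a0 a z.2 <= z.1]).
  move=> u v t /set_mem /= le_u /set_mem /= le_v; apply/mem_set => /=.
  rewrite [X in X <= _](affine_comb a0 a u.2 v.2 t%:num) //.
  by apply: lerD; apply: ler_wpM2l => //; rewrite subr_ge0.
by move=> z [Xz]; apply: le_trans; exact: le_f.
Qed.

(** Weak duality: the combination with weights lam of the inequalities of the
    polyhedron is the inequality mu - a^T x >= d^T lam, in which y has
    disappeared. *)
Lemma certificate_minorant X f a0 a lam :
    conv_hull (epigraph X f) = projected_polyhedron D A B d ->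
    certificate a0 a lam ->
  forall x, X x -> affine a0 a x <= f x.
Proof.
move=> epiE [a0_le Dlam Alam Blam lam_ge0] x Xx.
have : conv_hull (epigraph X f) (f x, x) by exact: sub_conv_hull.
rewrite epiE => -[y /= /(le_dot lam_ge0)].
rewrite !dotDl dotZl !dot_trmx Dlam Alam Blam dot0r addr0 mulr1 dotNr => le_d.
by rewrite /affine dotC -lerBrDr (le_trans a0_le).
Qed.

(** Strong duality, through [affine_farkas] in the variables (mu, x, y) with
    objective (1, - a, 0). *)
Lemma certificate_exists X f a0 a :
    conv_hull (epigraph X f) = projected_polyhedron D A B d -> X !=set0 ->
    (forall x, X x -> affine a0 a x <= f x) ->
  exists lam, certificate a0 a lam.
Proof.
move=> epiE [x0 Xx0] le_f.
pose M := row_mx (row_mx D A) B.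
have ME (s : R) x y : M *m col_mx (col_mx s%:M x) y =
    s *: D + A *m x + B *m y.
  by rewrite !mul_row_col mul_mx_scalar.
have epi0 : conv_hull (epigraph X f) (f x0, x0) by exact: sub_conv_hull.
rewrite epiE in epi0; have [y0 y0P] := epi0.
rewrite -ME in y0P.
have [z|lam [lam_ge0 lamE d_le]] :=
    @affine_farkas _ _ _ M d (col_mx (col_mx 1%:M (- a)) 0) a0 _ y0P.
  rewrite -[z]vsubmxK -[usubmx z]vsubmxK [usubmx (usubmx z)]mx11_scalar.
  move: (usubmx _ 0 0) (dsubmx (usubmx z)) (dsubmx z) => s x y.
  rewrite ME => sxy; have := @conv_hull_epigraph_ge _ _ _ _ le_f (s, x).
  rewrite epiE => /(_ (ex_intro _ y sxy)) /=.
  rewrite !dot_col_mx dot0l addr0 dot_scalar !mxE !mulr1n mul1r dotNl /affine.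
  by rewrite lerBrDr.
move: lamE; rewrite !tr_row_mx !mul_col_mx.
move=> /eq_col_mx[/eq_col_mx[Dlam Alam] Blam]; exists lam; split=> //.
by rewrite /dot Dlam mxE.
Qed.

End Duality.

Theorem theorem5 (R : realType) (n K : nat) (K_gt0 : (0 < K)%N)
  (X : set 'cV[R]_n) (f : 'I_K -> 'cV[R]_n -> R) (m p : 'I_K -> nat)
  (D : forall k, 'cV[R]_(p k)) (A : forall k, 'M[R]_(p k, n))
  (B : forall k, 'M[R]_(p k, m k)) (d : forall k, 'cV[R]_(p k))
  (X_binary : X `<=` binary (n := n))
  (epiE : forall k, conv_hull (epigraph X (f k)) =
                    projected_polyhedron (D k) (A k) (B k) (d k))
  (D_ge0 : forall k, le_entry 0 (D k))
  (xbar : 'cV[R]_n) (xbarX : conv_hull X xbar) :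
  let cf := convex_envelope X (pointwise_min K_gt0 f) in
  lp_value D A B d xbar (cf xbar) /\
  forall (a0 : R) (a : 'cV[R]_n) (lam : forall k, 'cV[R]_(p k)),
    lp_optimal D A B d xbar a0 a lam ->
    (forall x, conv_hull X x -> affine a0 a x <= cf x) /\
    affine a0 a xbar = cf xbar.
Proof.
move=> cf.
have feasible_le a0 a lam : lp_feasible D A B d a0 a lam ->
    forall x, conv_hull X x -> affine a0 a x <= cf x.
  move=> feas; apply: affine_le_envelope => // x Xx.
  by apply: le_bigmin => [|k _]; exact: (certificate_minorant (epiE _) (feas _)).
have [a0 [a [le_f aE]]] := envelope_support (pointwise_min K_gt0 f)
  X_binary xbarX.
have lamP k : exists lam, certificate (D k) (A k) (B k) (d k) a0 a lam.
  apply: (certificate_exists (epiE k) (conv_hull_nonempty xbarX)) => x Xx.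
  exact: le_trans (le_f x Xx) (bigmin_le _ _ _).
pose lam k := projT1 (cid (lamP k)).
have lam_feas : lp_feasible D A B d a0 a lam.
  by move=> k; exact: projT2 (cid (lamP k)).
split.
  exists a0, a, lam; split=> //; split=> // b0 b mu feas.
  by rewrite aE; exact: feasible_le feas _ xbarX.
move=> b0 b mu [feas opt]; split; first exact: feasible_le feas.
apply: le_anti; rewrite (feasible_le _ _ _ feas _ xbarX) /=.
by rewrite -/cf in aE; rewrite -aE; exact: opt lam_feas.
Qed.
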